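(* Let $\lambda\in\mathbb{C}$ and let $$K=x_1x_2(\partial_1\partial_2-\lambda)\circ\frac{1}{x_1x_2}\in\mathcal{D}.$$ Then the ring $R(K)$ is isomorphic to the ring $\mathcal{R}_\lambda$.
   Context: Here there are two variables: $\mathcal{D}=\mathbb{C}(x_1,x_2)[\partial_1,\partial_2]$ is the ring of differential operators with rational function coefficients ($\partial_i=\partial/\partial x_i$, product $\circ$ is composition), and $\mathcal{D}_0=\mathbb{C}[\partial_1,\partial_2]\subset\mathcal{D}$ is the subring of constant coefficient operators. For a non-zero $K\in\mathcal{D}$, $$R_0(K)=\{r\in\mathcal{D}_0 : K\circ r\in\mathcal{D}\circ K\},\qquad R(K)=(K\circ\mathcal{D}_0\circ K^{-1})\cap\mathcal{D}=K\circ R_0(K)\circ K^{-1},$$ with $K^{-1}$ the inverse of $K$ in a ring of microdifferential operators containing $\mathcal{D}$; equivalently, $R(K)$ is the commutative subring of all $Q\in\mathcal{D}$ such that $Q\circ K=K\circ r$ for some $r\in\mathcal{D}_0$. For the operator $K$ of the claim, $K$ is a right factor of $(\partial_1\partial_2-\lambda)^3$ and $R(K)$ is a maximal commutative subring of $\mathcal{D}$. For $\lambda\in\mathbb{C}$, $$\mathcal{R}_\lambda=\left\{q(x,y)\in\mathbb{C}[x,y] : q_x\left(z,\tfrac{\lambda}{z}\right)=q_y\left(z,\tfrac{\lambda}{z}\right)=q_{xy}\left(z,\tfrac{\lambda}{z}\right)\equiv 0\right\},$$ where subscripts denote partial derivatives and the identities hold identically in $z$ ($z\neq0$). In the paper's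 words, $\mathcal{R}_\lambda$ is the set of polynomials $q$ such that $q_x$, $q_y$ and $q_{xy}$ all have a factor of $xy-\lambda$. It is a subring of $\mathbb{C}[x,y]$.
   Formalization: The case λ = 0 is excluded, because the claim fails there: R(K) is then C[x²,x³,y²,y³], which is Noetherian, while the ring R_0 (C + y²C[x,y] as displayed, C + x²y²C[x,y] in the factor description) is not. *)

(* Defs.v *)
From HB Require Import structures.
From mathcomp Require Import all_boot all_order all_algebra.
From mathcomp Require Import mpoly.
From mathcomp Require Import boolp reals complex ring.

Set Implicit Arguments.
Unset Strict Implicit.
Unset Printing Implicit Defensive.

Import Order.TTheory GRing.Theory Num.Theory.
Local Open Scope ring_scope.
Local Open Scope quotient_scope.

Notation i1 := (ord0 : 'I_2).
Notation i2 := (ord_max : 'I_2).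

Notation "p %:F" := (@FracField.tofrac _ p) : ring_scope.

(* Over abstract rings, since [ring] and [field] do not terminate on fractions. *)
Lemma quot_rule_wd (A : comNzRingType) (n d m e n' d' m' e' : A) :
  n * e = m * d -> n' * e + n * e' = m' * d + m * d' ->
  (m' * e - m * e') * d ^+ 2 = (n' * d - n * d') * e ^+ 2.
Proof.
move=> E E'.
have -> : (m' * e - m * e') * d ^+ 2 = (n' * d - n * d') * e ^+ 2 +
  (d * e) * ((m' * d + m * d') - (n' * e + n * e')) +
  (d * e' + e * d') * (n * e - m * d) by ring.
by rewrite E E' !subrr !mulr0 !addr0.
Qed.

Lemma quot_ruleM (A : fieldType) (n d m e n' d' m' e' : A) :
  d != 0 -> e != 0 ->
  ((n' * m + n * m') * (d * e) - n * m * (d' * e + d * e')) / (d * e) ^+ 2 =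
  (n' * d - n * d') / d ^+ 2 * (m / e) + n / d * ((m' * e - m * e') / e ^+ 2).
Proof. by move=> d0 e0; field; rewrite d0 e0. Qed.

Lemma quot_ruleB (A : fieldType) (n d m e n' d' m' e' : A) :
  d != 0 -> e != 0 ->
  ((n' * e + n * e' - (m' * d + m * d')) * (d * e) -
    (n * e - m * d) * (d' * e + d * e')) / (d * e) ^+ 2 =
  (n' * d - n * d') / d ^+ 2 - (m' * e - m * e') / e ^+ 2.
Proof. by move=> d0 e0; field; rewrite d0 e0. Qed.

Lemma fracB (A : fieldType) (n d m e : A) : d != 0 -> e != 0 ->
  n / d - m / e = (n * e - m * d) / (d * e).
Proof. by move=> d0 e0; field; rewrite d0 e0. Qed.

Lemma comm_cancel (A : comNzRingType) (f fi fj fij fji d di dj dij : A) :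
  fij * d + fj * di + (fi * dj + f * dij) =
  fji * d + fi * dj + (fj * di + f * dij) -> fij * d = fji * d.
Proof.
move=> H; have -> : fij * d = fij * d + fj * di + (fi * dj + f * dij)
  - (fj * di + fi * dj + f * dij) by ring.
by rewrite H; ring.
Qed.

Definition ratfun (F : numFieldType) := {fraction {mpoly F[2]}}.

(* Quotient rule on the representative of f chosen by the library;
   [pd_div] shows independence of that choice. *)
HB.lock Definition pd (F : numFieldType) (i : 'I_2) (f : ratfun F) : ratfun F :=
  let n := \n_(repr f) in let d := \d_(repr f) in
  (n^`M(i) * d - n * d^`M(i))%:F / d%:F ^+ 2.

Section RatFun.
Variable F : numFieldType.
Local Notation ratfun := (ratfun F).
Implicit Types (f g : ratfun) (n d : {mpoly F[2]}).

Lemma denom_neq0 f : \d_(repr f) != 0.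
Proof. exact: denom_ratioP. Qed.

Lemma tofrac_neq0 d : d != 0 -> d%:F != 0 :> ratfun.
Proof. by rewrite tofrac_eq0. Qed.

Lemma ratfun_numden f : f = (\n_(repr f))%:F / (\d_(repr f))%:F.
Proof.
apply: (canRL (mulfK (tofrac_neq0 (denom_neq0 f)))).
have d0 := denom_neq0 f; rewrite -{1}[f]reprK; move: (repr f) d0 => x d0.
unlock FracField.tofrac; apply/esym; rewrite -[RHS]FracField.pi_mul.
apply/eqmodP; rewrite /= FracField.equivfE /FracField.mulf.
by rewrite !numden_Ratio ?mulf_neq0 ?oner_neq0 //= ?mulr1 ?mul1r // mulrC.
Qed.

Lemma ratfunP f : exists n d, d != 0 /\ f = n%:F / d%:F.
Proof.
by exists \n_(repr f), \d_(repr f); split;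
  [exact: denom_neq0 | exact: ratfun_numden].
Qed.

Lemma pd_div i n d : d != 0 ->
  pd i (n%:F / d%:F) = (n^`M(i) * d - n * d^`M(i))%:F / d%:F ^+ 2.
Proof.
move=> d0; set f := _ / _; rewrite unlock /=.
have e0 := denom_neq0 f; have := ratfun_numden f.
move: \n_(repr f) \d_(repr f) e0 => m e e0; rewrite /f.
move=> /eqP; rewrite GRing.eqr_div ?tofrac_neq0 // -!tofracM tofrac_eq => /eqP E.
apply/eqP; rewrite GRing.eqr_div ?expf_neq0 ?tofrac_neq0 //.
rewrite -!tofracXn -!tofracM tofrac_eq; apply/eqP.
by apply: quot_rule_wd => //; rewrite -!mderivM E.
Qed.

Lemma pd_poly i n : pd i n%:F = (n^`M(i))%:F.
Proof.
have -> : n%:F = n%:F / (1 : {mpoly F[2]})%:F :> ratfun.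
  by rewrite tofrac1 divr1.
rewrite pd_div ?oner_neq0 // tofrac1 expr1n divr1.
have -> : (1 : {mpoly F[2]})^`M(i) = 0 by rewrite -mpolyC1 mderivC.
by rewrite mulr0 subr0 mulr1.
Qed.

Lemma pdM i f g : pd i (f * g) = pd i f * g + f * pd i g.
Proof.
have [n [d [d0 ->]]] := ratfunP f; have [m [e [e0 ->]]] := ratfunP g.
rewrite mulf_div -!tofracM !pd_div ?mulf_neq0 // !mderivM.
rewrite !(tofracB, tofracD, tofracM).
by apply: quot_ruleM; rewrite tofrac_neq0.
Qed.

Lemma pdB i : zmod_morphism (@pd F i).
Proof.
move=> f g; have [n [d [d0 ->]]] := ratfunP f.
have [m [e [e0 ->]]] := ratfunP g.
rewrite fracB ?tofrac_neq0 // -!tofracM -tofracB.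
rewrite !pd_div ?mulf_neq0 // !(mderivM, mderivB).
rewrite !(tofracB, tofracD, tofracM).
by apply: quot_ruleB; rewrite tofrac_neq0.
Qed.

HB.instance Definition _ i :=
  GRing.isZmodMorphism.Build ratfun ratfun (@pd F i) (pdB i).

Lemma pdC i j f : pd i (pd j f) = pd j (pd i f).
Proof.
have [n [d [d0 Ef]]] := ratfunP f.
have E : f * d%:F = n%:F by rewrite Ef divfK ?tofrac_neq0.
have H : pd i (pd j (f * d%:F)) = pd j (pd i (f * d%:F)).
  by rewrite E !(pd_poly i, pd_poly j) mderiv_comm.
move: H; rewrite !pdM !raddfD /= !pdM !(pd_poly i, pd_poly j).
rewrite -(mderiv_comm i j) => /comm_cancel.
exact/mulIf/tofrac_neq0.
Qed.

End RatFun.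

(* The ring of additive endomorphisms, with composition as product. *)
Record endo (V : zmodType) := Endo {
  endo_fun :> V -> V;
  endo_zmod : zmod_morphism endo_fun }.

Section EndoRing.
Variable V : zmodType.
Implicit Types (P Q S : endo V).

Lemma endoP P Q : P =1 Q -> P = Q.
Proof.
case: P Q => [p hp] [q hq] /= /funext E; rewrite E in hp *.
by rewrite (Prop_irrelevance hp hq).
Qed.

HB.instance Definition _ := gen_eqMixin (endo V).
HB.instance Definition _ := gen_choiceMixin (endo V).

HB.instance Definition _ P :=
  GRing.isZmodMorphism.Build V V (endo_fun P) (endo_zmod P).

Fact endo0_subproof : zmod_morphism (fun _ : V => 0 : V).
Proof. by move=> x y; rewrite subr0. Qed.
Definition endo0 := Endo endo0_subproof.

Fact endoN_subproof P : zmod_morphism (fun x => - P x).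
Proof. by move=> x y; rewrite raddfB opprD. Qed.
Definition endoN P := Endo (endoN_subproof P).

Fact endoD_subproof P Q : zmod_morphism (fun x => P x + Q x).
Proof. by move=> x y; rewrite !raddfB opprD addrACA. Qed.
Definition endoD P Q := Endo (endoD_subproof P Q).

Fact endo1_subproof : zmod_morphism (@id V). Proof. by []. Qed.
Definition endo1 := Endo endo1_subproof.

Fact endoM_subproof P Q : zmod_morphism (fun x => P (Q x)).
Proof. by move=> x y; rewrite !raddfB. Qed.
Definition endoM P Q := Endo (endoM_subproof P Q).

Fact endo_addA : associative endoD.
Proof. by move=> P Q S; apply: endoP => x /=; rewrite addrA. Qed.
Fact endo_addC : commutative endoD.
Proof. by move=> P Q; apply: endoP => x /=; rewrite addrC. Qed.
Fact endo_add0 : left_id endo0 endoD.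
Proof. by move=> P; apply: endoP => x /=; rewrite add0r. Qed.
Fact endo_addN : left_inverse endo0 endoN endoD.
Proof. by move=> P; apply: endoP => x /=; rewrite addNr. Qed.

HB.instance Definition _ :=
  GRing.isZmodule.Build (endo V) endo_addA endo_addC endo_add0 endo_addN.

Fact endo_mulA : associative endoM.
Proof. by move=> P Q S; apply: endoP. Qed.
Fact endo_mul1l : left_id endo1 endoM.
Proof. by move=> P; apply: endoP. Qed.
Fact endo_mul1r : right_id endo1 endoM.
Proof. by move=> P; apply: endoP. Qed.
Fact endo_mulDl : left_distributive endoM +%R.
Proof. by move=> P Q S; apply: endoP. Qed.
Fact endo_mulDr : right_distributive endoM +%R.
Proof. by move=> P Q S; apply: endoP => x /=; rewrite raddfD. Qed.

HB.instance Definition _ := GRing.Zmodule_isPzRing.Build (endo V)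
  endo_mulA endo_mul1l endo_mul1r endo_mulDl endo_mulDr.

Lemma endo0E x : (0 : endo V) x = 0. Proof. by []. Qed.
Lemma endo1E x : (1 : endo V) x = x. Proof. by []. Qed.
Lemma endoNE P x : (- P) x = - P x. Proof. by []. Qed.
Lemma endoDE P Q x : (P + Q) x = P x + Q x. Proof. by []. Qed.
Lemma endoME P Q x : (P * Q) x = P (Q x). Proof. by []. Qed.

End EndoRing.

Section SkewMmap.
Variables (n : nat) (R S : nzRingType) (f : {rmorphism R -> S}).
Variables (h : 'I_n -> S) (delta : 'I_n -> R -> R).
Hypothesis hC : forall i j, h i * h j = h j * h i.
Hypothesis hf : forall i a, h i * f a = f (delta i a) + f a * h i.

Lemma mmap1E : mmap f h (1 : {mpoly R[n]}) = 1.
Proof. by rewrite -[X in mmap _ _ X]mpolyC1 mmapC /= rmorph1. Qed.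

Lemma skew_mmap1U i m : mmap1 h (U_(i) + m)%MM = h i * mmap1 h m.
Proof.
rewrite -[X in X * _]mmap1U /mmap1.
have comm (r : seq 'I_n) l : GRing.comm (h l) (\prod_(j <- r) h j ^+ U_(i)%MM j).
  by apply: commr_prod => j _; exact: commrX (hC _ _).
elim: (index_enum _) => [|j r IH]; first by rewrite !big_nil mulr1.
rewrite !big_cons IH mnmDE exprD -!mulrA; congr (_ * _); rewrite !mulrA.
by congr (_ * _); apply/commr_sym/commrX/commr_sym/comm.
Qed.

Lemma skew_mmapM (p q : {mpoly R[n]}) :
  exists r : {mpoly R[n]}, mmap f h p * mmap f h q = mmap f h r.
Proof.
pose I s := exists r : {mpoly R[n]}, s = mmap f h r.
have ID s t : I s -> I t -> I (s + t).
  by move=> [r ->] [u ->]; exists (r + u); rewrite raddfD.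
have IZ c s : I s -> I (f c * s).
  by move=> [r ->]; exists (c *: r); rewrite mmapZ.
have Ih i s : I s -> I (h i * s).
  case=> r ->; elim/mpolyind: r => [|c m r _ _ IHr].
    by rewrite raddf0 mulr0; exists 0; rewrite raddf0.
  rewrite raddfD mulrDr /=; apply/ID => //.
  rewrite mmapZ mulrA hf mulrDl; apply/ID.
    by apply/IZ; exists 'X_[m].
  rewrite -mulrA; apply/IZ; exists 'X_[U_(i) + m].
  by rewrite !mmapX skew_mmap1U.
suff /(_ p) : forall p, I (mmap f h p * mmap f h q) by [].
elim/mpolyind => [|c m r _ _ IHr]; first by exists 0; rewrite !raddf0 mul0r.
rewrite raddfD mulrDl /=; apply/ID => //; rewrite mmapZ -mulrA; apply/IZ.
rewrite mmapX /mmap1.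
have : I (mmap f h q) by exists q.
elim/big_rec: _ (mmap f h q) => [s|i x _ IHx s Is]; first by rewrite mul1r.
rewrite -mulrA; elim: (m i) => [|k IHk]; first by rewrite expr0 mul1r; apply/IHx.
by rewrite exprS -mulrA; apply/Ih.
Qed.

End SkewMmap.

Section DiffOp.
Variable F : numFieldType.
Local Notation ratfun := (ratfun F).
Local Notation endo := (endo ratfun).

Fact endo_neq0 : 1 != 0 :> endo.
Proof.
apply/eqP => /(congr1 (fun P : endo => P 1)); rewrite endo1E endo0E.
exact/eqP/oner_neq0.
Qed.

HB.instance Definition _ := GRing.PzSemiRing_isNonZero.Build endo endo_neq0.

Fact mulop_subproof (a : ratfun) : zmod_morphism (fun f => a * f).
Proof. by move=> f g; rewrite mulrBr. Qed.
Definition mulop (a : ratfun) : endo := Endo (mulop_subproof a).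

Definition partial (i : 'I_2) : endo := @Endo ratfun (@pd F i) (@pdB F i).

Definition ratC (c : F) : ratfun := (c%:MP_[2])%:F.

Definition constop (c : F) : endo := mulop (ratC c).

(* D acts faithfully on rational functions in characteristic 0, so D is taken
   to be the ring of operators f |-> \sum_m a_m * partial^m f, and D0 the ring
   of those with constant coefficients. *)
Definition diffop_of (A : {mpoly ratfun[2]}) : endo := mmap mulop partial A.

Definition constop_of (q : {mpoly F[2]}) : endo :=
  mmap constop partial q.

Definition D : {pred endo} := [pred P | `[< exists A, P = diffop_of A >]].

Definition D0 : {pred endo} := [pred P | `[< exists q, P = constop_of q >]].

Lemma mulopB : zmod_morphism mulop.
Proof. by move=> a b; apply: endoP => f /=; rewrite mulrBl. Qed.
Lemma mulopM : monoid_morphism mulop.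
Proof. by split=> [|a b]; apply: endoP => f /=; rewrite ?mul1r ?mulrA. Qed.
HB.instance Definition _ := GRing.isZmodMorphism.Build ratfun endo mulop mulopB.
HB.instance Definition _ :=
  GRing.isMonoidMorphism.Build ratfun endo mulop mulopM.

Lemma ratC_B : zmod_morphism ratC.
Proof. by move=> a b; rewrite /ratC mpolyCB tofracB. Qed.
Lemma ratC_M : monoid_morphism ratC.
Proof. by split=> [|a b]; rewrite /ratC ?mpolyC1 ?mpolyCM ?tofrac1 ?tofracM. Qed.
HB.instance Definition _ := GRing.isZmodMorphism.Build F ratfun ratC ratC_B.
HB.instance Definition _ := GRing.isMonoidMorphism.Build F ratfun ratC ratC_M.

HB.instance Definition _ := GRing.RMorphism.copy constop (mulop \o ratC).

Lemma partialC i j : partial i * partial j = partial j * partial i.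
Proof. by apply: endoP => f; rewrite !endoME /= pdC. Qed.

Lemma partial_mulop i a :
  partial i * mulop a = mulop (pd i a) + mulop a * partial i.
Proof. by apply: endoP => f; rewrite !(endoME, endoDE) /= pdM. Qed.

Lemma partial_constop i c :
  partial i * constop c = constop 0 + constop c * partial i.
Proof.
by rewrite raddf0 /constop partial_mulop /ratC pd_poly mderivC tofrac0 raddf0.
Qed.

Lemma D_subring : subring_closed D.
Proof.
split.
- by apply/asboolP; exists 1; rewrite /diffop_of mmap1E.
- move=> P Q /asboolP[A ->] /asboolP[B ->]; apply/asboolP; exists (A - B).
  by rewrite /diffop_of raddfB.
- move=> P Q /asboolP[A ->] /asboolP[B ->]; apply/asboolP.
  exact: (skew_mmapM (delta := @pd F) partialC partial_mulop).
Qed.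
HB.instance Definition _ := GRing.isSubringClosed.Build endo D D_subring.

Lemma D0_subring : subring_closed D0.
Proof.
split.
- by apply/asboolP; exists 1; rewrite /constop_of mmap1E.
- move=> P Q /asboolP[A ->] /asboolP[B ->]; apply/asboolP; exists (A - B).
  by rewrite /constop_of raddfB.
- move=> P Q /asboolP[A ->] /asboolP[B ->]; apply/asboolP.
  exact: (skew_mmapM (delta := fun _ _ => 0) partialC partial_constop).
Qed.
HB.instance Definition _ := GRing.isSubringClosed.Build endo D0 D0_subring.

(* Equivalent to (K D0 K^-1) \cap D, without microdifferential operators. *)
Definition RK (K : endo) : {pred endo} :=
  [pred Q | `[< Q \in D /\ exists2 r, r \in D0 & Q * K = K * r >]].

Lemma RK_subring K : subring_closed (RK K).
Proof.
split.
- apply/asboolP; split; first exact: rpred1.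
  by exists 1; [exact: rpred1 | rewrite mul1r mulr1].
- move=> P Q /asboolP[DP [r Dr Er]] /asboolP[DQ [s Ds Es]]; apply/asboolP.
  split; first exact: rpredB.
  by exists (r - s); [exact: rpredB | rewrite mulrBl mulrBr Er Es].
- move=> P Q /asboolP[DP [r Dr Er]] /asboolP[DQ [s Ds Es]]; apply/asboolP.
  split; first exact: rpredM.
  by exists (r * s); [exact: rpredM | rewrite -mulrA Es mulrA Er mulrA].
Qed.
HB.instance Definition _ K := GRing.isSubringClosed.Build endo (RK K) (RK_subring K).

Record RK_ring (K : endo) := RKRing { RK_val :> endo; _ : RK_val \in RK K }.
HB.instance Definition _ K := [isSub for @RK_val K].
HB.instance Definition _ K := [Choice of RK_ring K by <:].
HB.instance Definition _ K := [SubChoice_isSubNzRing of RK_ring K by <:].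

(* (z, lambda / z), at which q_x, q_y and q_xy must vanish for all z <> 0. *)
Definition hyperbola (lambda z : F) : 2.-tuple F := [tuple z; lambda / z].

Definition Rlambda (lambda : F) : {pred {mpoly F[2]}} :=
  [pred q : {mpoly F[2]} | `[< forall z, z != 0 ->
    [/\ q^`M(i1).@[tnth (hyperbola lambda z)] = 0,
        q^`M(i2).@[tnth (hyperbola lambda z)] = 0
      & q^`M(i1)^`M(i2).@[tnth (hyperbola lambda z)] = 0] >]].

Lemma Rlambda_subring lambda : subring_closed (Rlambda lambda).
Proof.
split.
- have d1 i : (1 : {mpoly F[2]})^`M(i) = 0 by rewrite -mpolyC1 mderivC.
  by apply/asboolP => z _; rewrite !d1 mderiv0 meval0.
- move=> p q /asboolP Hp /asboolP Hq; apply/asboolP => z z0.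
  have [p1 p2 p3] := Hp z z0; have [q1 q2 q3] := Hq z z0.
  by rewrite !mderivB !mevalB p1 p2 p3 q1 q2 q3 subrr.
- move=> p q /asboolP Hp /asboolP Hq; apply/asboolP => z z0.
  have [p1 p2 p3] := Hp z z0; have [q1 q2 q3] := Hq z z0.
  rewrite !(mderivM, mderivD) !(mevalM, mevalD) p1 p2 p3 q1 q2 q3.
  by rewrite !(mul0r, mulr0, addr0).
Qed.
HB.instance Definition _ lambda :=
  GRing.isSubringClosed.Build {mpoly F[2]} (Rlambda lambda)
    (Rlambda_subring lambda).

Record Rlambda_ring (lambda : F) :=
  RlambdaRing { Rlambda_val :> {mpoly F[2]}; _ : Rlambda_val \in Rlambda lambda }.
HB.instance Definition _ lambda := [isSub for @Rlambda_val lambda].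
HB.instance Definition _ lambda := [Choice of Rlambda_ring lambda by <:].
HB.instance Definition _ lambda :=
  [SubChoice_isSubComNzRing of Rlambda_ring lambda by <:].

Definition x1 : ratfun := ('X_i1)%:F.
Definition x2 : ratfun := ('X_i2)%:F.

Definition K_lambda (lambda : F) : endo :=
  mulop (x1 * x2) * (partial i1 * partial i2 - constop lambda)
    * mulop (x1 * x2)^-1.

Lemma K_lambda_D lambda : K_lambda lambda \in D.
Proof.
have mD a : mulop a \in D.
  by apply/asboolP; exists a%:MP; rewrite /diffop_of mmapC.
have pD i : partial i \in D.
  by apply/asboolP; exists 'X_i; rewrite /diffop_of mmapX mmap1U.
exact: rpredM (rpredM (mD _) (rpredB (rpredM (pD _) (pD _)) (mD _))) (mD _).
Qed.

End DiffOp.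

(* Main.v *)
Require Import Defs.
From HB Require Import structures.
From mathcomp Require Import all_boot all_order all_algebra.
From mathcomp Require Import mpoly.
From mathcomp Require Import boolp reals complex.
From mathcomp Require Import ring.

Set Implicit Arguments.
Unset Strict Implicit.
Unset Printing Implicit Defensive.

Import Order.TTheory GRing.Theory Num.Theory.
Local Open Scope ring_scope.

(** Write [ell = X1 X2 - lambda] and [M] for multiplication by [x1 x2], so that
    [K = M ell(d) M^-1].  An operator of [D] is determined by its symbol, the
    polynomial in the commuting variables [X1, X2] obtained by writing all
    coefficients on the left ([diffop_inj]).  Two rules compute with symbols:
    composing on the right with a constant coefficient operator multiplies
    symbols ([diffop_mul_const]), and composing on the right with [M] applies
    the differential operator [xy_conj] to the symbol ([diffop_mulop_xy]).

    The operator [M K] has symbol [tau = x1 x2 ell - x1 X1 - x2 X2 + 1]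
    ([mulop_xy_K]).  Multiplying [Q K = K q(d)] by [M] on both sides thus turns
    it into an identity of polynomials: if [A] is the symbol of [M Q M],
<<
      A ell = xy_conj (tau q)                                 (intertwineP)
>>
    and by [xy_conj_tauM] the right-hand side is, modulo [ell],
<<
      - (x2^2 X2 q_1 + x1^2 X1 q_2 + (x1 X1 + x2 X2 - 1) q_12).
>>
    An intertwiner [Q] exists exactly when [ell] divides this polynomial over
    the field of rational functions.  If it does, evaluation at
    [(z, lambda / z)] leaves a vanishing polynomial in [x1, x2] with constant
    coefficients; comparing the coefficients of [x2^2], [x1^2] and [1] gives
    the vanishing of [q_1], [q_2] and [q_12] at that point, which is
    [q \in Rlambda].  Conversely, a polynomial vanishing on the hyperbola is
    divisible by [ell] ([hyperbola_poly_dvd]), so that for [q \in Rlambda] the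
    quotient [A] exists and [Q = M^-1 A(d) M^-1] is an intertwiner.

    As symbols live in an integral domain and [tau], [ell] are non-zero, the
    equation [Q K = K q(d)] makes [Q] and [q] determine each other, so the map
    [Q |-> q] is an isomorphism. *)

(** * Induction on multivariate polynomials *)

Lemma mnm_succ n (m : 'X_{1..n}) : m != 0%MM -> exists i m', m = (m' + U_(i))%MM.
Proof.
move=> m0; have [i mi] : exists i, m i != 0%N.
  apply/existsP; apply: contraR m0; rewrite negb_exists => /forallP m0.
  by apply/eqP/mnmP=> i; rewrite mnm0E; move: (m0 i); rewrite negbK => /eqP.
by exists i, (m - U_(i))%MM; rewrite submK // lep1mP.
Qed.

Lemma mpoly_mulX_ind (n : nat) (R : nzRingType) (P : {mpoly R[n]} -> Prop) :
  (forall c, P c%:MP) -> (forall p q, P p -> P q -> P (p + q)) ->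
  (forall i p, P p -> P (p * 'X_i)) -> forall p, P p.
Proof.
move=> PC PD PX; elim/mpolyind => [|c m p _ _ Pp].
  by rewrite -[0]mpolyC0; apply: PC.
apply: (PD) => //; rewrite -mul_mpolyC.
have [k] := ubnP (mdeg m); elim: k m => // k IHk m le_m.
have [->|m0] := eqVneq m 0%MM; first by rewrite mpolyX0 mulr1; apply: PC.
have [i [m' Em]] := mnm_succ m0.
rewrite Em mpolyXD mulrA; apply/PX/IHk.
by move: le_m; rewrite {1}Em mdegD mdeg1 addn1 ltnS.
Qed.

(** * Polynomials vanishing on a hyperbola *)

Definition hyperbola_poly (R : comNzRingType) (c : R) : {mpoly R[2]} :=
  'X_i1 * 'X_i2 - c%:MP.

Section Hyperbola.
Variables (F : numFieldType) (lambda : F).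
Hypothesis lambda0 : lambda != 0.
Implicit Types (p q : {mpoly F[2]}) (f g : {poly F}).

Let inX1 f : {mpoly F[2]} := (map_poly (@mpolyC 2 F) f).['X_i1].

(** Modulo [X1 X2 - lambda] every monomial multiplied by a large enough power
    of [X1] becomes a polynomial in [X1] alone, as [X1 X2] can be replaced by
    [lambda]; this reduces vanishing on the hyperbola to one variable. *)
Lemma inX1_reduce p : exists N f s,
  'X_i1 ^+ N * p = inX1 f + s * hyperbola_poly lambda.
Proof.
elim/mpoly_mulX_ind: p => [c|p q [N [f [s Ep]]] [M [g [t Eq]]]|i p [N [f [s Ep]]]].
- exists 0%N, c%:P, 0.
  by rewrite /inX1 map_polyC hornerC mul0r addr0 expr0 mul1r.
- exists (N + M)%N, ('X^M * f + 'X^N * g), ('X_i1 ^+ M * s + 'X_i1 ^+ N * t).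
  rewrite /inX1 !(rmorphD, rmorphM) /= !map_polyXn.
  rewrite hornerD !hornerM !hornerXn -![horner _ _]/(inX1 _).
  move: Ep Eq; move: (inX1 f) (inX1 g) (hyperbola_poly _) ('X_i1).
  move=> {}f {}g h x Ep Eq.
  transitivity (x ^+ M * (x ^+ N * p) + x ^+ N * (x ^+ M * q)).
    by rewrite exprD mulrDr !mulrA [x ^+ M * _]mulrC.
  by rewrite Ep Eq !mulrDr !mulrDl !mulrA addrACA.
- have [->|->] : i = i1 \/ i = i2.
    case: i => [[|[|k]] ik] //; [left|right]; exact: val_inj.
  + exists N, (f * 'X), (s * 'X_i1).
    rewrite /inX1 rmorphM /= map_polyX hornerM hornerX -/(inX1 f).
    by rewrite mulrA Ep mulrDl mulrAC.
  + exists N.+1, (f * lambda%:P), ('X_i1 ^+ N * p + lambda%:MP * s).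
    rewrite /inX1 rmorphM /= map_polyC hornerM hornerC -/(inX1 f).
    rewrite [LHS](_ : _ = 'X_i1 ^+ N * p * (hyperbola_poly lambda + lambda%:MP)).
      by rewrite mulrDr mulrDl [in X in _ + X]Ep; ring.
    by rewrite /hyperbola_poly subrK exprS; ring.
Qed.

Lemma poly_eq0_off0 f : (forall z, z != 0 -> f.[z] = 0) -> f = 0.
Proof.
move=> f0; apply/eqP; apply: contraT => nz.
have := @max_poly_roots _ f [seq k.+1%:R | k <- iota 0 (size f)] nz.
rewrite size_map size_iota ltnn; apply.
  by apply/allP=> _ /mapP[k _ ->]; apply/eqP/f0; rewrite pnatr_eq0.
by rewrite map_inj_uniq ?iota_uniq // => a b /eqP; rewrite eqr_nat => /eqP[].
Qed.

Lemma meval_inX1 v f : (inX1 f).@[v] = f.[v i1].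
Proof.
rewrite /inX1 -horner_map /= mevalXU -map_poly_comp.
by rewrite map_poly_id // => c _ /=; rewrite mevalC.
Qed.

Lemma hyperbola_poly_on z : z != 0 ->
  (hyperbola_poly lambda).@[tnth (hyperbola lambda z)] = 0.
Proof.
move=> z0; rewrite /hyperbola_poly mevalB mevalM !mevalXU mevalC !(tnth_nth 0) /=.
by rewrite mulrC divfK ?subrr.
Qed.

(** As [lambda != 0], the variable [X1] is invertible modulo [X1 X2 - lambda],
    with inverse [X2 / lambda]. *)
Lemma hyperbola_poly_dvdX p s : 'X_i1 * p = s * hyperbola_poly lambda ->
  exists t, p = t * hyperbola_poly lambda.
Proof.
move=> E; exists (lambda^-1%:MP * ('X_i2 * s - p)).
rewrite -mulrA mulrBl -[X in X - _]mulrA -E.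
have -> : 'X_i2 * ('X_i1 * p) - p * hyperbola_poly lambda = lambda%:MP * p.
  by rewrite /hyperbola_poly; ring.
by rewrite mulrA -mpolyCM mulVf // mul1r.
Qed.

(** The case of the Nullstellensatz that is needed here: by [inX1_reduce] the
    remainder of [X1 ^ N p] is a polynomial in one variable vanishing at all
    [z != 0], and [X1 ^ N] can then be cancelled. *)
Lemma hyperbola_poly_dvd p :
  (forall z, z != 0 -> p.@[tnth (hyperbola lambda z)] = 0) ->
  exists s, p = s * hyperbola_poly lambda.
Proof.
move=> p0; have [N [f [s E]]] := inX1_reduce p.
have f0 : f = 0.
  apply: poly_eq0_off0 => z z0.
  have := congr1 (meval (tnth (hyperbola lambda z))) E.
  rewrite mevalM p0 // mulr0 mevalD mevalM hyperbola_poly_on //.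
  rewrite mulr0 addr0 meval_inX1.
  by rewrite (tnth_nth 0) /= => <-.
move: E; rewrite f0 /inX1 rmorph0 horner0 add0r.
elim: N s => [|N IH] s; first by rewrite mul1r; exists s.
by rewrite exprS -mulrA => /hyperbola_poly_dvdX[t /IH].
Qed.

End Hyperbola.

(** * Symbol calculus for composition with x1 x2 *)

Section ConjugationSymbol.
Variables (R : comNzRingType) (x y c : R).
Implicit Types p q : {mpoly R[2]}.

(** By the Leibniz rule, this is the symbol of [P] composed on the right with
    multiplication by [x y], for [p] the symbol of [P]. *)
Definition xy_conj p : {mpoly R[2]} :=
  (x * y)%:MP * p + x%:MP * p^`M(i2) + y%:MP * p^`M(i1) + p^`M(i1)^`M(i2).

(** The symbol of [x y K], where [K] is the operator [d1 d2 - c] conjugated by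
    multiplication by [x y]. *)
Definition tau : {mpoly R[2]} :=
  (x * y)%:MP * hyperbola_poly c - x%:MP * 'X_i1 - y%:MP * 'X_i2 + 1.

Lemma mderivXU (i j : 'I_2) : ('X_j : {mpoly R[2]})^`M(i) = (i == j)%:R.
Proof.
rewrite mderivX mnmE eq_sym; case: eqP => [->|_]; last by rewrite scale0r.
by rewrite scale1r -[X in (X - _)%MM]addm0 addmC addmK mpolyX0.
Qed.

Lemma mderiv_hyperbola1 : (hyperbola_poly c)^`M(i1) = 'X_i2.
Proof.
rewrite /hyperbola_poly mderivB mderivC mderivM !mderivXU /=.
by rewrite mulr0 mul1r addr0 subr0.
Qed.

Lemma mderiv_hyperbola2 : (hyperbola_poly c)^`M(i2) = 'X_i1.
Proof.
rewrite /hyperbola_poly mderivB mderivC mderivM !mderivXU /=.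
by rewrite mulr1 mul0r add0r subr0.
Qed.

Lemma mderiv_one i : (1 : {mpoly R[2]})^`M(i) = 0.
Proof. by rewrite -mpolyC1 mderivC. Qed.

Lemma mderiv_tau1 : tau^`M(i1) = (x * y)%:MP * 'X_i2 - x%:MP.
Proof.
rewrite /tau mderivD !mderivB !mderiv_mulC mderiv_hyperbola1.
rewrite !mderivXU mderiv_one /=.
by rewrite mulr1 mulr0 subr0 addr0.
Qed.

Lemma mderiv_tau2 : tau^`M(i2) = (x * y)%:MP * 'X_i1 - y%:MP.
Proof.
rewrite /tau mderivD !mderivB !mderiv_mulC mderiv_hyperbola2.
rewrite !mderivXU mderiv_one /=.
by rewrite mulr1 mulr0 subr0 addr0.
Qed.

Lemma mderiv_tau12 : tau^`M(i1)^`M(i2) = (x * y)%:MP.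
Proof.
by rewrite mderiv_tau1 mderivB mderiv_mulC mderivXU mderivC /= mulr1 subr0.
Qed.

(** The Leibniz expansion around [tau]: the combinations [xy_conj tau],
    [x tau + tau_1] and [y tau + tau_2] that multiply [q], [q_2] and [q_1]
    collapse modulo [X1 X2 - c] to [0], [- x^2 X1] and [- y^2 X2]. *)
Lemma xy_conj_tauM q : xy_conj (tau * q) =
  ((x * y)%:MP ^+ 2 * q + (x ^+ 2 * y)%:MP * q^`M(i2)
     + (x * y ^+ 2)%:MP * q^`M(i1) + (x * y)%:MP * q^`M(i1)^`M(i2))
    * hyperbola_poly c
  - ((y ^+ 2)%:MP * ('X_i2 * q^`M(i1)) + (x ^+ 2)%:MP * ('X_i1 * q^`M(i2))
     + (x%:MP * 'X_i1 + y%:MP * 'X_i2 - 1) * q^`M(i1)^`M(i2)).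
Proof.
rewrite /xy_conj.
have := mderiv_tau12; have := mderiv_tau2; have := mderiv_tau1.
(* [tau] is made opaque, so that the Leibniz rule does not expand it. *)
move Et: tau => t; rewrite !(mderivM, mderivD) => -> -> ->.
by rewrite -Et /tau !(mpolyCM, rmorphXn) /=; ring.
Qed.

Lemma xy_conj_tau : xy_conj tau = (x * y)%:MP ^+ 2 * hyperbola_poly c.
Proof.
rewrite -[tau]mulr1 xy_conj_tauM !(mderiv_one, mderiv0) !(mulr0, addr0).
by rewrite subr0 mulr1.
Qed.

Lemma meval_remainder (z w : R) p q r (v := tnth [tuple z; w]) :
  ((y ^+ 2)%:MP * ('X_i2 * p) + (x ^+ 2)%:MP * ('X_i1 * q)
     + (x%:MP * 'X_i1 + y%:MP * 'X_i2 - 1) * r).@[v] =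
  y ^+ 2 * (w * p.@[v]) + x ^+ 2 * (z * q.@[v]) + (x * z + y * w - 1) * r.@[v].
Proof.
rewrite !(mevalD, mevalN, mevalM, meval1) !mevalXU !mevalC.
by rewrite /v !(tnth_nth 0).
Qed.

End ConjugationSymbol.

(** * Symbols of differential operators *)

HB.lock Definition const_symb (F : numFieldType) (q : {mpoly F[2]}) :
  {mpoly (ratfun F)[2]} := map_mpoly (@ratC F) q.

Section Symbols.
Variable F : numFieldType.
Local Notation ratfun := (ratfun F).
Local Notation endo := (endo ratfun).
Local Notation diffop := (@diffop_of F).
Implicit Types (A B : {mpoly ratfun[2]}) (p q : {mpoly F[2]}).

Lemma const_symbX i : const_symb ('X_i : {mpoly F[2]}) = 'X_i.
Proof. rewrite unlock; exact: map_mpolyX. Qed.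

Lemma const_symbC c : const_symb (c%:MP : {mpoly F[2]}) = (ratC c)%:MP.
Proof. rewrite unlock; exact: map_mpolyC. Qed.

Lemma const_symbD p q : const_symb (p + q) = const_symb p + const_symb q.
Proof. rewrite unlock; exact: raddfD. Qed.

Lemma const_symbB p q : const_symb (p - q) = const_symb p - const_symb q.
Proof. rewrite unlock; exact: raddfB. Qed.

Lemma const_symbM p q : const_symb (p * q) = const_symb p * const_symb q.
Proof. rewrite unlock; exact: rmorphM. Qed.

Lemma mcoeff_const_symb m q : (const_symb q)@_m = ratC q@_m.
Proof. rewrite unlock; exact: mcoeff_map_mpoly. Qed.

Lemma constop_ofD p q : constop_of (p + q) = constop_of p + constop_of q.
Proof. exact: raddfD. Qed.

Lemma diffopD A B : diffop (A + B) = diffop A + diffop B.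
Proof. exact: raddfD. Qed.

Lemma constop_ofE q : constop_of q = diffop (const_symb q).
Proof.
rewrite unlock; elim/mpolyind: q => [|c m p _ _ IH].
  by rewrite /diffop_of /constop_of !raddf0.
transitivity (constop_of (c *: 'X_[m]) + constop_of p); first exact: raddfD.
transitivity (diffop (map_mpoly (@ratC F) (c *: 'X_[m]))
    + diffop (map_mpoly (@ratC F) p)).
  congr (_ + _); last exact: IH.
  by rewrite /diffop_of /constop_of mmapZ map_mpolyZ mmapZ map_mpolyX !mmapX.
by rewrite -diffopD; congr (diffop _); exact/esym/raddfD.
Qed.

Lemma diffop_mulC c A : diffop (c%:MP * A) = mulop c * diffop A.
Proof. by rewrite mul_mpolyC /diffop_of mmapZ. Qed.

Lemma diffop_mulX A i : diffop (A * 'X_i) = diffop A * partial F i.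
Proof.
elim/mpolyind: A => [|c m A _ _ IH].
  by rewrite mul0r /diffop_of !raddf0 mul0r.
rewrite mulrDl !diffopD mulrDl IH; congr (_ + _).
rewrite -scalerAl -!mul_mpolyC !diffop_mulC -mulrA; congr (_ * _).
rewrite -mpolyXD addmC /diffop_of !mmapX skew_mmap1U; last exact: partialC.
by apply: commr_prod => j _; apply/commrX/partialC.
Qed.

Lemma diffop_mul_constop A c :
  diffop (A * (ratC c)%:MP) = diffop A * constop c.
Proof.
elim/mpoly_mulX_ind: A => [a|A B IHA IHB|i A IH].
- by rewrite mulrC diffop_mulC /diffop_of !mmapC /= -!rmorphM mulrC.
- by rewrite mulrDl !diffopD mulrDl IHA IHB.
- rewrite mulrAC !diffop_mulX IH -!mulrA partial_constop.
  by rewrite raddf0 add0r.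
Qed.

(** Constant coefficients commute with the derivations, so no derivative of a
    coefficient appears. *)
Lemma diffop_mul_const A q :
  diffop (A * const_symb q) = diffop A * constop_of q.
Proof.
elim/mpoly_mulX_ind: q A => [c|p q IHp IHq|i q IH] A.
- by rewrite const_symbC diffop_mul_constop /constop_of mmapC.
- rewrite const_symbD constop_ofD (mulrDr A) diffopD (mulrDr (diffop A)).
  by congr (_ + _); [exact: IHp | exact: IHq].
- rewrite constop_ofE const_symbM const_symbX.
  by rewrite mulrA !diffop_mulX IH mulrA constop_ofE.
Qed.

Lemma constop_ofM p q : constop_of (p * q) = constop_of p * constop_of q.
Proof.
by rewrite constop_ofE const_symbM diffop_mul_const -constop_ofE.
Qed.

(** The commutator with a variable acts on symbols as a partial derivative, as
    [d_i^k x_i = x_i d_i^k + k d_i^(k-1)]. *)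
Lemma diffop_mulop_var A i :
  diffop A * mulop ('X_i)%:F = diffop (('X_i)%:F%:MP * A + A^`M(i)).
Proof.
elim/mpoly_mulX_ind: A => [c|A B IHA IHB|j A IH].
- rewrite mderivC addr0 diffop_mulC /diffop_of !mmapC /= -!rmorphM.
  by rewrite mulrC.
- by rewrite mderivD mulrDr addrACA !diffopD mulrDl IHA IHB !diffopD.
- rewrite diffop_mulX -mulrA partial_mulop pd_poly mderivXU mulrDr mulrA IH.
  rewrite mderivM mderivXU mulrA !diffopD diffop_mulX mulrDl -!diffop_mulX.
  rewrite addrC -addrA; congr (_ + (_ + _)).
  rewrite eq_sym; case: eqP => _.
    by rewrite tofrac1 rmorph1 !mulr1.
  by rewrite tofrac0 rmorph0 !mulr0 /diffop_of raddf0.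
Qed.

Lemma diffop_one A : diffop A 1 = A@_0.
Proof.
elim/mpoly_mulX_ind: A => [c|A B IHA IHB|i A IH].
- by rewrite /diffop_of mmapC /= mulr1 mcoeffC eqxx mulr1.
- by rewrite diffopD mcoeffD endoDE IHA IHB.
- rewrite diffop_mulX endoME /= -tofrac1 pd_poly mderiv_one tofrac0 raddf0.
  by rewrite rmorphM /= mcoeffX mnm1_eq0 mulr0.
Qed.

Lemma ratfun_natS_neq0 n : n.+1%:R != 0 :> ratfun.
Proof.
by rewrite -(rmorph_nat (@FracField.tofrac {mpoly F[2]})) tofrac_eq0 -mpolyC_nat
  mpolyC_eq0 pnatr_eq0.
Qed.

(** If [A] acts as zero, then so do its commutators with the variables, whose
    symbols are the derivatives of [A]; these are zero by induction on the
    degree of the coefficient examined, and in characteristic zero this leaves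
    only the constant term of [A], which is its action on [1]. *)
Lemma diffop_inj0 A : diffop A = 0 -> A = 0.
Proof.
move=> A0; apply/mpolyP => m; rewrite mcoeff0.
have [k] := ubnP (mdeg m); elim: k m A A0 => // k IHk m A A0 le_m.
have [->|m0] := eqVneq m 0%MM; first by rewrite -diffop_one A0.
have [i [m' Em]] := mnm_succ m0.
have dA : diffop A^`M(i) = 0.
  have := diffop_mulop_var A i.
  by rewrite diffopD diffop_mulC A0 mul0r mulr0 add0r => /esym.
have := IHk m' _ dA; rewrite mcoeff_deriv -Em -mulr_natr.
move=> /(_ _)/eqP; rewrite mulf_eq0 (negPf (ratfun_natS_neq0 _)) orbF.
by move=> H; apply/eqP/H; move: le_m; rewrite {1}Em mdegD mdeg1 addn1 ltnS.
Qed.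

Lemma diffop_inj A B : diffop A = diffop B -> A = B.
Proof.
move=> E; apply/eqP; rewrite -subr_eq0; apply/eqP/diffop_inj0.
by rewrite /diffop_of raddfB /= -!/(diffop _) E subrr.
Qed.

Lemma diffop_mulop_xy A :
  diffop A * mulop (x1 F * x2 F) = diffop (xy_conj (x1 F) (x2 F) A).
Proof.
have -> : mulop (x1 F * x2 F) = mulop (x1 F) * mulop (x2 F).
  exact: rmorphM.
rewrite mulrA; pose B := (x1 F)%:MP * A + A^`M(i1).
transitivity (diffop B * mulop (x2 F)).
  by congr (_ * _); exact: diffop_mulop_var.
transitivity (diffop ((x2 F)%:MP * B + B^`M(i2))); first exact: diffop_mulop_var.
congr (diffop _); rewrite /B /xy_conj; move: (x1 F) (x2 F) => x y.
rewrite mderivD mderiv_mulC mpolyCM; ring.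
Qed.

End Symbols.

(** * Intertwiners of K *)

Lemma sandwich_inj (E : pzRingType) (M N P Q : E) :
  M * N = 1 -> N * M = 1 -> M * P * M = M * Q * M -> P = Q.
Proof.
move=> MN NM H.
have /(congr1 (fun S => N * S * N)) := H.
by rewrite !mulrA NM !mul1r -!mulrA MN !mulr1.
Qed.

(** Constants are compared as coefficients of [x2^2], [x1^2] and [1]; the
    points [(0, 0)], [(0, 1)] and [(1, 0)] suffice to isolate them. *)
Lemma remainder_coefs0 (F : numFieldType) (a b c d e : F) :
  x2 F ^+ 2 * (ratC d * ratC a) + x1 F ^+ 2 * (ratC c * ratC b)
    + (x1 F * ratC c + x2 F * ratC d - 1) * ratC e = 0 ->
  [/\ d * a = 0, c * b = 0 & e = 0].
Proof.
pose P : {mpoly F[2]} :=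
  'X_i2 ^+ 2 * (d%:MP * a%:MP) + 'X_i1 ^+ 2 * (c%:MP * b%:MP)
    + ('X_i1 * c%:MP + 'X_i2 * d%:MP - 1) * e%:MP.
move=> E; have P0 : P = 0.
  apply/eqP; rewrite -tofrac_eq0 /P.
  rewrite !(tofracD, tofracN, tofracM, tofracXn, tofrac1).
  by rewrite -!expr2; apply/eqP.
have ev s t : t ^+ 2 * (d * a) + s ^+ 2 * (c * b) + (s * c + t * d - 1) * e = 0.
  have := congr1 (meval (tnth [tuple s; t])) P0.
  rewrite /P meval0 !(mevalD, mevalN, mevalM, meval1) !mevalXU !mevalC.
  by rewrite -!expr2 !(tnth_nth 0) /=.
have e0 : e = 0.
  have := ev 0 0; rewrite expr0n /= !mul0r !add0r mulN1r => /eqP.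
  by rewrite oppr_eq0 => /eqP.
split=> //.
  by have := ev 0 1; rewrite e0 expr0n expr1n mulr0 mul0r !addr0 mul1r.
by have := ev 1 0; rewrite e0 expr0n expr1n mulr0 mul0r addr0 add0r mul1r.
Qed.

Section Main.
Variables (F : numFieldType) (lambda : F).
Hypothesis lambda0 : lambda != 0.
Local Notation ratfun := (ratfun F).
Local Notation endo := (endo ratfun).
Local Notation diffop := (@diffop_of F).
Local Notation x := (x1 F).
Local Notation y := (x2 F).
Local Notation M := (mulop (x * y)).
Local Notation N := (mulop (x * y)^-1).
Local Notation K := (K_lambda lambda).
Local Notation ell := (hyperbola_poly (ratC lambda)).
Local Notation tauK := (tau x y (ratC lambda)).
Implicit Types (A B C : {mpoly ratfun[2]}) (p q : {mpoly F[2]}) (P Q : endo).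

Lemma xy_neq0 : x * y != 0.
Proof.
have X0 i : ('X_i : {mpoly F[2]})%:F != 0 :> ratfun.
  by rewrite tofrac_eq0 -msize_poly_eq0 msizeX.
by apply: mulf_neq0; apply: X0.
Qed.

Lemma mulop_xyK : M * N = 1.
Proof. by apply: endoP => f /=; rewrite mulrA divff ?mul1r // xy_neq0. Qed.

Lemma mulop_xyVK : N * M = 1.
Proof. by apply: endoP => f /=; rewrite mulrA mulVf ?mul1r // xy_neq0. Qed.

Lemma diffop_D A : diffop A \in @D F.
Proof. by apply/asboolP; exists A. Qed.

Lemma mulop_D a : mulop a \in @D F.
Proof. by apply/asboolP; exists a%:MP; rewrite /diffop_of mmapC. Qed.

Lemma const_symb_ell : const_symb (hyperbola_poly lambda) = ell.
Proof.
by rewrite /hyperbola_poly const_symbB const_symbM !const_symbX const_symbC.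
Qed.

Lemma diffop_mul_ell A : diffop (A * ell) = diffop A * diffop ell.
Proof. by rewrite -const_symb_ell diffop_mul_const constop_ofE. Qed.

Lemma diffop_ell :
  diffop ell = partial F i1 * partial F i2 - constop lambda.
Proof.
transitivity (diffop ('X_i1 * 'X_i2) - diffop (ratC lambda)%:MP).
  exact: raddfB.
rewrite diffop_mulX; congr (_ * _ - _); last by rewrite /diffop_of mmapC.
by rewrite /diffop_of mmapX mmap1U.
Qed.

Lemma K_lambdaE : K = M * diffop ell * N.
Proof. by rewrite diffop_ell. Qed.

(** Both sides are compared after composing with [M] on the right, where no
    inverse of [x1 x2] has to be differentiated. *)
Lemma mulop_xy_K : M * K = diffop tauK.
Proof.
have E : diffop tauK * M = M * M * diffop ell.
  rewrite diffop_mulop_xy xy_conj_tau -mulrA.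
  transitivity (M * diffop ((x * y)%:MP * ell)); last first.
    by congr (_ * _); exact: diffop_mulC.
  rewrite -[RHS]diffop_mulC; congr (diffop _).
  by rewrite expr2 -mulrA.
transitivity (diffop tauK * M * N); last by rewrite -mulrA mulop_xyK mulr1.
by rewrite E K_lambdaE !mulrA.
Qed.

Lemma sandwich_symbol Q : Q \in @D F -> exists A, M * Q * M = diffop A.
Proof.
move=> DQ; apply/asboolP.
exact: (rpredM (rpredM (mulop_D _) DQ) (mulop_D _)).
Qed.

Lemma sandwich_QK Q A : M * Q * M = diffop A ->
  M * (Q * K) * M = diffop (A * ell).
Proof.
move=> EA; rewrite diffop_mul_ell -EA K_lambdaE.
by rewrite -!mulrA mulop_xyVK mulr1.
Qed.

Lemma sandwich_Kr q :
  M * (K * constop_of q) * M = diffop (xy_conj x y (tauK * const_symb q)).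
Proof.
rewrite -diffop_mulop_xy diffop_mul_const mulrA.
by congr (_ * _ * _); exact: mulop_xy_K.
Qed.

(** The intertwining relation is equivalent to its product with the invertible
    [M] on both sides, all of whose terms have known symbols. *)
Lemma intertwineP Q q A : M * Q * M = diffop A ->
  Q * K = K * constop_of q <->
  A * ell = xy_conj x y (tauK * const_symb q).
Proof.
move=> /sandwich_QK EA; have Eq := sandwich_Kr q; split=> E.
  apply: diffop_inj; transitivity (M * (Q * K) * M); first exact/esym.
  by rewrite E; exact: Eq.
apply: (sandwich_inj mulop_xyK mulop_xyVK).
by rewrite EA E; exact/esym.
Qed.

Lemma meval_ell (z w : F) : z * w = lambda ->
  ell.@[tnth [tuple ratC z; ratC w]] = 0.
Proof.
move=> zw; rewrite /hyperbola_poly mevalB mevalM !mevalXU mevalC !(tnth_nth 0) /=.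
by apply/eqP; rewrite subr_eq0 -zw; apply/eqP/esym; exact: rmorphM.
Qed.

Lemma meval_const_symb (z w : F) q :
  (const_symb q).@[tnth [tuple ratC z; ratC w]] =
  ratC q.@[tnth [tuple z; w]].
Proof.
elim/mpoly_mulX_ind: q => [a|p q IHp IHq|i q IH].
- by rewrite const_symbC !mevalC.
- rewrite const_symbD !mevalD.
  transitivity (ratC p.@[tnth [tuple z; w]] + ratC q.@[tnth [tuple z; w]]).
    by congr (_ + _).
  exact/esym/rmorphD.
- rewrite const_symbM const_symbX !mevalM !mevalXU.
  transitivity (ratC q.@[tnth [tuple z; w]] * ratC (tnth [tuple z; w] i)).
    congr (_ * _); first exact: IH.
    by case: i => [[|[|k]] ik]; rewrite ?(tnth_nth 0).
  exact/esym/rmorphM.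
Qed.

Lemma const_symb_deriv i q : (const_symb q)^`M(i) = const_symb q^`M(i).
Proof.
apply/mpolyP => m; rewrite mcoeff_deriv !mcoeff_const_symb mcoeff_deriv.
exact/esym/rmorphMn.
Qed.

Lemma const_symb_inj : injective (@const_symb F).
Proof.
move=> p q E; apply/mpolyP => m; apply: (@fmorph_inj _ _ (@ratC F)).
transitivity (const_symb p)@_m; first exact/esym/mcoeff_const_symb.
by rewrite E; exact: mcoeff_const_symb.
Qed.

Lemma ell_neq0 : ell != 0.
Proof.
apply/eqP => /(congr1 (fun p : {mpoly _[2]} => p^`M(i1)^`M(i2))).
by rewrite mderiv_hyperbola1 mderivXU !mderiv0 => /eqP; rewrite oner_eq0.
Qed.

Lemma tau_neq0 : tauK != 0.
Proof.
apply/eqP => /(congr1 (fun p : {mpoly _[2]} => p^`M(i1)^`M(i2))).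
by rewrite mderiv_tau12 !mderiv0 => /eqP; rewrite mpolyC_eq0 (negPf xy_neq0).
Qed.

(** The symbol identity of [intertwineP] is evaluated at [(z, lambda / z)],
    where [ell] vanishes; [lambda != 0] allows the factor [lambda / z] of [q_1]
    to be cancelled. *)
Lemma intertwine_Rlambda Q q :
  Q \in @D F -> Q * K = K * constop_of q -> q \in Rlambda lambda.
Proof.
move=> /sandwich_symbol[A EA] /(intertwineP q EA); rewrite xy_conj_tauM => E.
apply/asboolP => z z0; set w := lambda / z.
have zw : z * w = lambda by rewrite /w mulrC divfK.
have w0 : w != 0 by apply: mulf_neq0; rewrite ?invr_eq0.
have := congr1 (meval (tnth [tuple ratC z; ratC w])) E.
rewrite !const_symb_deriv mevalM (meval_ell zw) mulr0.
rewrite mevalB mevalM (meval_ell zw) mulr0 sub0r => /esym/eqP.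
rewrite oppr_eq0 => /eqP.
rewrite meval_remainder !meval_const_symb => /remainder_coefs0[].
move=> /eqP; rewrite mulf_eq0 (negPf w0) => /eqP q1.
by move=> /eqP; rewrite mulf_eq0 (negPf z0) => /eqP q2 q12.
Qed.

Lemma symbol_uniq p q : K * constop_of p = K * constop_of q -> p = q.
Proof.
move=> E; apply: const_symb_inj; apply: (mulfI tau_neq0); apply: diffop_inj.
rewrite !diffop_mul_const.
transitivity (M * (K * constop_of p)).
  by rewrite mulrA; congr (_ * _); exact/esym/mulop_xy_K.
by rewrite E mulrA; congr (_ * _); exact/mulop_xy_K.
Qed.

Lemma intertwine_inj P Q :
  P \in @D F -> Q \in @D F -> P * K = Q * K -> P = Q.
Proof.
move=> /sandwich_symbol[A EA] /sandwich_symbol[B EB] E.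
apply: (sandwich_inj mulop_xyK mulop_xyVK); rewrite EA EB; congr (diffop _).
apply: (mulIf ell_neq0); apply: diffop_inj.
transitivity (M * (P * K) * M); first exact/esym/sandwich_QK.
by rewrite E; exact/sandwich_QK.
Qed.

(** The three derivatives of [q] are multiples of [X1 X2 - lambda], hence so is
    the polynomial to be divided in [intertwineP]. *)
Lemma Rlambda_intertwine q : q \in Rlambda lambda ->
  exists2 Q, Q \in @D F & Q * K = K * constop_of q.
Proof.
move=> /asboolP qR.
have [s1 E1] : exists s, q^`M(i1) = s * hyperbola_poly lambda.
  by apply: hyperbola_poly_dvd => // z /qR[].
have [s2 E2] : exists s, q^`M(i2) = s * hyperbola_poly lambda.
  by apply: hyperbola_poly_dvd => // z /qR[].
have [s3 E3] : exists s, q^`M(i1)^`M(i2) = s * hyperbola_poly lambda.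
  by apply: hyperbola_poly_dvd => // z /qR[].
have [C EC] : exists C, xy_conj x y (tauK * const_symb q) = C * ell.
  rewrite xy_conj_tauM !const_symb_deriv E3 E1 E2 !const_symbM const_symb_ell.
  rewrite !mulrA -!mulrDl -mulrBl.
  by eexists; reflexivity.
exists (N * diffop C * N).
  exact: (rpredM (rpredM (mulop_D _) (diffop_D _)) (mulop_D _)).
apply/(@intertwineP _ _ C); last exact/esym.
by rewrite !mulrA mulop_xyK mul1r -mulrA mulop_xyVK mulr1.
Qed.

(** * The isomorphism *)

Lemma RK_symbol (Q : RK_ring K) :
  exists q, q \in Rlambda lambda /\ RK_val Q * K = K * constop_of q.
Proof.
have /asboolP[DQ [_ /asboolP[q ->] E]] := valP Q.
by exists q; split=> //; exact: intertwine_Rlambda E.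
Qed.

Definition symbol_of (Q : RK_ring K) : Rlambda_ring lambda :=
  RlambdaRing (proj1 (projT2 (cid (RK_symbol Q)))).

Lemma symbol_ofP (Q : RK_ring K) :
  RK_val Q * K = K * constop_of (symbol_of Q).
Proof. exact: proj2 (projT2 (cid (RK_symbol Q))). Qed.

Lemma symbol_of_eq (Q : RK_ring K) (q : Rlambda_ring lambda) :
  RK_val Q * K = K * constop_of q -> symbol_of Q = q.
Proof. by move=> E; apply/val_inj/symbol_uniq; rewrite -E -symbol_ofP. Qed.

Lemma constop_ofB p q : constop_of (p - q) = constop_of p - constop_of q.
Proof. exact: raddfB. Qed.

Fact symbol_of_zmod : zmod_morphism symbol_of.
Proof.
move=> P Q; apply: symbol_of_eq.
transitivity ((RK_val P - RK_val Q) * K); first by [].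
transitivity (K *
  constop_of (Rlambda_val (symbol_of P) - Rlambda_val (symbol_of Q))).
  by rewrite constop_ofB mulrBl mulrBr !symbol_ofP.
by [].
Qed.

Fact symbol_of_monoid : monoid_morphism symbol_of.
Proof.
split=> [|P Q]; apply: symbol_of_eq.
  transitivity (K * constop_of 1); last by [].
  by rewrite /constop_of mmap1E mulr1; exact: mul1r.
transitivity (RK_val P * RK_val Q * K); first by [].
transitivity (K *
  constop_of (Rlambda_val (symbol_of P) * Rlambda_val (symbol_of Q))).
  rewrite constop_ofM [RHS]mulrA -symbol_ofP -(mulrA (RK_val P) K).
  by rewrite -symbol_ofP -[LHS]mulrA.
by [].
Qed.

HB.instance Definition _ := GRing.isZmodMorphism.Build
  (RK_ring K) (Rlambda_ring lambda) symbol_of symbol_of_zmod.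
HB.instance Definition _ := GRing.isMonoidMorphism.Build
  (RK_ring K) (Rlambda_ring lambda) symbol_of symbol_of_monoid.

Lemma RK_D (Q : RK_ring K) : val Q \in @D F.
Proof. by have /asboolP[] := valP Q. Qed.

Lemma symbol_of_inj : injective symbol_of.
Proof.
move=> P Q E; apply/val_inj/intertwine_inj; try exact: RK_D.
by rewrite [LHS]symbol_ofP [RHS]symbol_ofP E.
Qed.

Lemma symbol_of_surj (q : Rlambda_ring lambda) :
  exists Q : RK_ring K, symbol_of Q = q.
Proof.
have [Q DQ E] := Rlambda_intertwine (valP q).
have RQ : Q \in RK K.
  apply/asboolP; split=> //; exists (constop_of (val q)) => //.
  by apply/asboolP; exists (val q).
by exists (RKRing RQ); apply: symbol_of_eq.
Qed.

Lemma symbol_of_bij : bijective symbol_of.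
Proof.
have inv (q : Rlambda_ring lambda) := cid (symbol_of_surj q).
exists (fun q : Rlambda_ring lambda => projT1 (inv q)) => [Q|q].
  by apply: symbol_of_inj; exact: projT2 (inv _).
exact: projT2 (inv q).
Qed.

End Main.

Theorem theorem2p2 (R : realType) (lambda : R[i]) (hlambda : lambda != 0) :
  exists phi : {rmorphism RK_ring (K_lambda lambda) -> Rlambda_ring lambda},
    bijective phi.
Proof.
by exists (symbol_of hlambda); exact: symbol_of_bij.
Qed.
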